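(* Let $\mathcal{H}=\{rrb,bbr,yyr\}$. Then $h_2(n,\mathcal{H})=\lceil n/2\rceil$.
   Context: Here $n$ denotes the number of vertices of the complete graph $K_n$. Edge-colorings of $K_n$ use colors from $\{r,b,y\}$ (red, blue, yellow); they need not be proper, and not all colors need be used. A pattern is an edge-colored triangle, denoted by the multiset of the colors of its three edges; e.g. $rrb$ is the triangle with two red edges and one blue edge, $bbr$ has two blue edges and one red edge, $yyr$ has two yellow edges and one red edge. For a family $\mathcal{H}$ of patterns, $\operatorname{Forb}(n,\mathcal{H})$ is the set of all edge-colorings of $K_n$ with colors from $\{r,b,y\}$ in which no triangle has a coloring belonging to $\mathcal{H}$. For an edge-coloring $c$ of $K_n$, $h_2(c)$ is the maximum $k$ such that there is a set of $k$ vertices whose induced edges use at most two of the three colors. Finally, $h_2(n,\mathcal{H})=\min\{h_2(c): c\in\operatorname{Forb}(n,\mathcal{H})\}$.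
   Formalization: The case n = 2 is excluded: every coloring of the single edge of K_2 lies in Forb(2,H) and has h_2(c) = 2, whereas ⌈2/2⌉ = 1, so the stated equality fails there; it is proved for all other n. *)

(* Defs.v *)
From HB Require Import structures.
From mathcomp Require Import all_boot.

Set Implicit Arguments.
Unset Strict Implicit.
Unset Printing Implicit Defensive.

Inductive color := red | blue | yellow.

Definition color_encode (x : color) : option bool :=
  match x with red => None | blue => Some false | yellow => Some true end.

Definition color_decode (o : option bool) : color :=
  match o with None => red | Some false => blue | Some true => yellow end.

Lemma color_encodeK : cancel color_encode color_decode.
Proof. by case. Qed.

HB.instance Definition _ := Finite.copy color (can_type color_encodeK).

(* Edges of K_n are the 2-element subsets of the vertex set. *)
Definition edge (n : nat) := {e : {set 'I_n} | #|e| == 2}.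

Definition coloring (n : nat) := {ffun edge n -> color}.

(* The colors of the edges induced by S, listed with multiplicity; this list
   is only meaningful up to permutation. *)
Definition edge_colors (n : nat) (c : coloring n) (S : {set 'I_n}) : seq color :=
  [seq c e | e : edge n in [pred e : edge n | val e \subset S]].

(* The three entries stand for a multiset: they are only ever compared up to
   permutation. *)
Definition pattern := 3.-tuple color.

Definition rrb : pattern := [tuple red; red; blue].
Definition bbr : pattern := [tuple blue; blue; red].
Definition yyr : pattern := [tuple yellow; yellow; red].

Definition Forb (n : nat) (H : seq pattern) : {set coloring n} :=
  [set c : coloring n |
    [forall T : {set 'I_n}, (#|T| == 3) ==>
      ~~ has (fun p : pattern => perm_eq (edge_colors c T) p) H]].

Definition h2 (n : nat) (c : coloring n) : nat :=
  \max_(S : {set 'I_n} | size (undup (edge_colors c S)) <= 2) #|S|.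

(* Since h2 c <= n for every c, the starting value n does not affect the
   minimum; it is the (junk) value when Forb n H is empty. *)
Definition h2_min (n : nat) (H : seq pattern) : nat :=
  \big[minn/n]_(c in Forb n H) h2 c.

(* Main.v *)
Require Import Defs.
From mathcomp Require Import all_boot.
From mathcomp Require Import all_order.

(** Lower bound. Let [c] avoid the three patterns. If no edge is red, the whole
    vertex set is two-colored. If [xyz] is a red triangle, every other vertex is
    joined in yellow to at most one of [x], [y], [z] and in red to the others, so
    any two vertices have a common red neighbor among them, which forbids blue:
    again the whole vertex set is two-colored. Otherwise let [uv] be red and in
    no red triangle: every other vertex is joined in yellow to [u] or to [v], and
    [u] together with its yellow neighborhood spans no red edge, likewise for
    [v]; these two sets cover the vertices, so one of them is large enough.

    Upper bound. Let the red edges form a matching of the [n] vertices (missing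
    at most one vertex) and let each vertex outside a matching edge be joined to
    its ends by one blue and one yellow edge. Two-colored sets then meet each
    matching edge in at most one vertex, or are contained in one matching edge. *)

Set Implicit Arguments.
Unset Strict Implicit.
Unset Printing Implicit Defensive.

(* On the diagonal this takes the junk value [red]. *)
Definition edge_color n (c : coloring n) (x y : 'I_n) : color :=
  if insub [set x; y] is Some e then c e else red.

Lemma edge_colorC n (c : coloring n) x y : edge_color c x y = edge_color c y x.
Proof. by rewrite /edge_color setUC. Qed.

Lemma edge_colorE n (c : coloring n) (e : edge n) x y :
  val e = [set x; y] -> edge_color c x y = c e.
Proof. by rewrite /edge_color => <-; rewrite valK. Qed.

Lemma edge_exists n (x y : 'I_n) :
  x != y -> exists e : edge n, val e = [set x; y].
Proof.
move=> xy; have xy2 : #|[set x; y]| == 2 by rewrite cards2 xy.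
by exists (Sub [set x; y] xy2); rewrite SubK.
Qed.

Lemma edge_colorsP n (c : coloring n) (S : {set 'I_n}) k :
  reflect (exists x y, [/\ x \in S, y \in S, x != y & edge_color c x y = k])
          (k \in edge_colors c S).
Proof.
apply: (iffP imageP) => [[e eS ->]|[x [y [xS yS xy <-]]]].
  have /cards2P[x [y [xy exy]]] := valP e.
  move: eS; rewrite inE exy subUset !sub1set => /andP[xS yS].
  by exists x, y; split=> //; apply: edge_colorE.
have [e exy] := edge_exists xy.
by exists e; rewrite ?(edge_colorE _ exy) // inE exy subUset !sub1set xS.
Qed.

Lemma edge_colors_triangle n (c : coloring n) x y z :
  x != y -> y != z -> x != z ->
  perm_eq (edge_colors c [set x; y; z])
          [:: edge_color c x y; edge_color c y z; edge_color c x z].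
Proof.
move=> xy yz xz.
have [e1 E1] := edge_exists xy; have [e2 E2] := edge_exists yz.
have [e3 E3] := edge_exists xz.
rewrite (edge_colorE _ E1) (edge_colorE _ E2) (edge_colorE _ E3).
have -> : [:: c e1; c e2; c e3] = map c [:: e1; e2; e3] by [].
have neq (e e' : edge n) w : w \in val e -> w \notin val e' -> e != e'.
  by move=> we; apply: contraNneq => <-.
have [yx zy zx] : [/\ y != x, z != y & z != x] by split; rewrite eq_sym.
have e12 : e1 != e2 by apply: (@neq _ _ x); rewrite ?E1 ?E2 !inE ?eqxx ?negb_or ?xy.
have e13 : e1 != e3.
  by apply: (@neq _ _ y); rewrite ?E1 ?E3 !inE ?eqxx ?orbT ?negb_or ?yx.
have e23 : e2 != e3 by apply: (@neq _ _ y); rewrite ?E2 ?E3 !inE ?eqxx ?negb_or ?yx.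
(* Both lists of edges are duplicate-free, so it is enough that they have the same members. *)
apply/perm_map/uniq_perm; first exact: enum_uniq.
  by rewrite /= !inE negb_or e12 e13 e23.
move=> e; rewrite mem_enum !inE.
apply/idP/idP => [|/or3P[]/eqP->]; last 3 first.
- by rewrite E1 subsetUl.
- by rewrite E2 -setUA subsetUr.
- by rewrite E3 subUset !sub1set !inE !eqxx !orbT.
have /cards2P[a [b [ab eab]]] := valP e.
rewrite -!val_eqE /= !E1 E2 E3 eab subUset !sub1set !inE -!orbA.
case/andP=> /or3P[]/eqP ea /or3P[]/eqP eb; move: ab; rewrite {}ea {}eb ?eqxx // => _.
all: by rewrite ?[[set y; x]]setUC ?[[set z; x]]setUC ?[[set z; y]]setUC ?eqxx ?orbT.
Qed.

Lemma ForbP n (c : coloring n) (H : seq pattern) :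
  reflect (forall x y z, x != y -> y != z -> x != z ->
            ~~ has (fun p : pattern => perm_eq
                 [:: edge_color c x y; edge_color c y z; edge_color c x z] p) H)
          (c \in Forb n H).
Proof.
rewrite inE; apply: (iffP forallP) => [cH x y z xy yz xz|cH T].
  have T3 : #|[set x; y; z]| == 3 by rewrite -setUA cardsU1 !inE negb_or xy xz cards2 yz.
  have := cH [set x; y; z]; rewrite T3 /=; apply: contra; apply: sub_has => p.
  by rewrite /= (permPl (edge_colors_triangle c xy yz xz)).
apply/implyP => T3; have /card_gt0P[x xT] : 0 < #|T| by rewrite (eqP T3).
have: #|T :\ x| == 2 by move: T3; rewrite (cardsD1 x) xT.
case/cards2P=> y [z [yz Tx]].
have /setD1P[yx _] : y \in T :\ x by rewrite Tx !inE eqxx.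
have /setD1P[zx _] : z \in T :\ x by rewrite Tx !inE eqxx orbT.
rewrite eq_sym in yx; rewrite eq_sym in zx.
rewrite -(setD1K xT) Tx setUA.
apply: contra (cH x y z yx yz zx); apply: sub_has => p.
by rewrite /= (permPl (edge_colors_triangle c yx yz zx)).
Qed.

(** Pigeonhole on the three colors. It lets two-colored sets be handled below through a single
    missing color [k]. *)
Lemma size_undup_le2 (s : seq color) :
  reflect (exists k, k \notin s) (size (undup s) <= 2).
Proof.
have all3 : forall k, k \in [:: red; blue; yellow] by case.
apply: (iffP idP) => [s2|[k ks]].
  apply/existsP; rewrite -[[exists _, _]]negbK negb_exists.
  apply: contraL s2 => /forallP full; rewrite -ltnNge.
  have -> : 3 = size [:: red; blue; yellow] by [].
  by apply: uniq_leq_size => // k _; rewrite mem_undup; apply/negPn/full.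
rewrite -(@leq_add2l 1) add1n.
have -> : (size (undup s)).+1 = size (k :: undup s) by [].
apply: (@leq_trans (size [:: red; blue; yellow])) => //.
by apply: uniq_leq_size => [|i _]; rewrite ?all3 //= mem_undup ks undup_uniq.
Qed.

Lemma leq_h2 n (c : coloring n) (S : {set 'I_n}) k :
  {in S &, forall x y, x != y -> edge_color c x y != k} -> #|S| <= h2 c.
Proof.
move=> Sk; apply: (leq_bigmax_cond (F := fun S : {set 'I_n} => #|S|)).
apply/size_undup_le2; exists k; apply/edge_colorsP => -[x [y [xS yS xy]]].
by apply/eqP/Sk.
Qed.

Lemma h2_leP n (c : coloring n) m :
  (forall (S : {set 'I_n}) k,
     {in S &, forall x y, x != y -> edge_color c x y != k} -> #|S| <= m) ->
  h2 c <= m.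
Proof.
move=> Sm; apply/bigmax_leqP => S /size_undup_le2[k kS]; apply: (Sm S k).
move=> x y xS yS xy; apply: contra kS => /eqP <-.
by apply/edge_colorsP; exists x, y.
Qed.

Lemma h2_lower n (c : coloring n) :
  c \in Forb n [:: rrb; bbr; yyr] -> uphalf n <= h2 c.
Proof.
move=> /ForbP cF; pose col := edge_color c.
have colC x y : col x y = col y x by apply: edge_colorC.
have tri x y z : x != y -> y != z -> x != z ->
    ~~ has (fun p : pattern => perm_eq [:: col x y; col y z; col x z] p)
         [:: rrb; bbr; yyr] by apply: cF.
have whole k : (forall x y, x != y -> col x y != k) -> uphalf n <= h2 c.
  move=> nk; apply: (@leq_trans #|[set: 'I_n]|).
    by rewrite cardsT card_ord leq_uphalf_double -addnn leq_addr.
  by apply: (@leq_h2 _ _ _ k) => x y _ _; apply: nk.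
have [/existsP[u /existsP[v /andP[uv /eqP cuv]]]|nored] :=
  boolP [exists u, exists v, (u != v) && (col u v == red)]; last first.
  apply: (whole red) => x y xy; move: nored.
  by rewrite negb_exists => /forallP/(_ x); rewrite negb_exists => /forallP/(_ y);
     rewrite xy.
(* The allowed triangles with a red edge are red-red-red, red-red-yellow and red-blue-yellow. *)
have red_edge w : w != u -> w != v ->
    [\/ col w u = red /\ col w v = red, col w u = yellow | col w v = yellow].
  move=> wu wv; have := tri w u v wu uv wv; rewrite cuv.
  by case: (col w u); case: (col w v) => // _;
    [apply: Or31 | apply: Or33 | apply: Or33 | apply: Or32 | apply: Or32].
have [/existsP[t /and4P[tu tv /eqP ctu /eqP ctv]]|notri] :=
  boolP [exists t, [&& t != u, t != v, col t u == red & col t v == red]].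
  apply: (whole blue) => x y xy; apply/eqP => cxy.
  have common w : w != x -> w != y -> col w x = red -> col w y = red -> False.
    move=> wx wy cx cy; have := tri w x y wx xy wy.
    by rewrite cx cy cxy.
  (* Counting a vertex as adjacent to itself spares a separate treatment of the vertices of the red
     triangle. *)
  pose adj w a := (w == a) || (col w a == red).
  (* If neither edge from [w] to [a], [b] is red, one is blue and the other yellow. The blue one
     forces the edge from [w] to [d] to be yellow, which together with the other yields [yyr]. *)
  have adj2 w a b d : a != b -> b != d -> a != d ->
      col a b = red -> col b d = red -> col a d = red -> adj w a || adj w b.
    move=> ab bd ad cab cbd cad; rewrite /adj.
    have [//|wa] := eqVneq w a; have [|wb] := eqVneq w b; first by rewrite orbT.
    have [->|wd] := eqVneq w d; first by rewrite ![col d _]colC cad.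
    have := tri w a b wa ab wb; have := tri w b d wb bd wd.
    have := tri w a d wa ad wd; rewrite cab cbd cad.
    by case: (col w a); case: (col w b); case: (col w d).
  have no_common a : ~~ (adj x a && adj y a).
    apply/negP; rewrite /adj; have [<-|xa] := eqVneq x a.
      by rewrite [y == x]eq_sym (negPf xy) colC cxy.
    have [<-|ya] := eqVneq y a; first by rewrite cxy.
    case/andP=> /eqP cxa /eqP cya.
    by apply: (@common a); rewrite 1?eq_sym // colC.
  rewrite eq_sym in tu; rewrite eq_sym in tv.
  have vu : v != u by rewrite eq_sym.
  rewrite colC in ctu; rewrite colC in ctv.
  have cvu : col v u = red by rewrite colC.
  have tv' : t != v by rewrite eq_sym.
  have ctv' : col t v = red by rewrite colC.
  have adj_tri w : [&& adj w u || adj w v, adj w v || adj w t & adj w u || adj w t].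
    by rewrite (adj2 w u v t) // (adj2 w v t u) ?(adj2 w u t v) // ?[col t u]colC // eq_sym.
  (* Each of [x] and [y] is adjacent to at least two of [u], [v], [t], so they share one of them. *)
  have := no_common u; have := no_common v; have := no_common t.
  move: (adj_tri x) (adj_tri y).
  by do 6?[case: (adj _ _)].
pose Y (w : 'I_n) := [set x | (x == w) || (col x w == yellow)].
(* A red edge between two yellow neighbors of [w] would complete the pattern [yyr]. *)
have Yle w : #|Y w| <= h2 c.
  apply: (@leq_h2 _ _ _ red) => x y; rewrite -/(col x y) !inE.
  case/predU1P=> [->|/eqP cx] /predU1P[->|/eqP cy] xy.
  - by rewrite eqxx in xy.
  - by rewrite colC cy.
  - by rewrite cx.
  have [xw|xw] := eqVneq x w; first by rewrite xw colC cy.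
  have [yw|yw] := eqVneq y w; first by rewrite yw cx.
  rewrite eq_sym in yw; have := tri x w y xw yw xy.
  by rewrite cx [col w y]colC cy; case: (col x y).
rewrite leq_uphalf_double -addnn.
apply: leq_trans (leq_add (Yle u) (Yle v)).
apply: leq_trans (leq_card_setU _ _).
rewrite -[n in n <= _]card_ord -cardsT; apply/subset_leq_card/subsetP => w _.
rewrite !inE; have [//|wu] := eqVneq w u; have [->|wv] := eqVneq w v.
  by rewrite !orbT.
have [[cu cv]|->|->] := red_edge w wu wv; rewrite ?eqxx ?orbT //.
by case/existsP: notri; exists w; rewrite wu wv cu cv.
Qed.

(** The red matching pairs [2i] with [2i + 1]; parity chooses between blue and yellow. An edge is an
    unordered set, so each test ranges over all pairs of its ends. *)
Definition matching_coloring n : coloring n :=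
  [ffun e : edge n =>
     if [forall x in val e, forall y in val e, x./2 == y./2] then red
     else if [forall x in val e, forall y in val e, odd x == odd y] then blue
     else yellow].

Lemma forall_in_set2 n (T : eqType) (f : 'I_n -> T) (a b : 'I_n) :
  [forall x in [set a; b], forall y in [set a; b], f x == f y] = (f a == f b).
Proof.
apply/idP/idP => [/forall_inP/(_ a (set21 a b))/forall_inP/(_ b (set22 a b)) //|ab].
apply/forall_inP => x /set2P xab; apply/forall_inP => y /set2P yab.
by case: xab => ->; case: yab => ->; rewrite ?eqxx // eq_sym.
Qed.

Lemma matching_coloringE n (x y : 'I_n) : x != y ->
  edge_color (matching_coloring n) x y =
    if x./2 == y./2 then red else if odd x == odd y then blue else yellow.
Proof.
move=> xy; have [e exy] := edge_exists xy; rewrite (edge_colorE _ exy) ffunE exy.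
by rewrite (forall_in_set2 (fun i => i./2)) (forall_in_set2 (fun i => odd i)).
Qed.

Lemma odd_half_inj x y : x./2 = y./2 -> odd x = odd y -> x = y.
Proof. by move=> h o; rewrite -(odd_double_half x) h o odd_double_half. Qed.

Lemma matched_odd n (x y : 'I_n) : x != y -> x./2 = y./2 -> odd y = ~~ odd x.
Proof.
move=> xy hxy; case: (boolP (odd x == odd y)) => [/eqP oxy|].
  by case/eqP: xy; apply/val_inj/odd_half_inj.
by case: (odd x); case: (odd y).
Qed.

(** Every forbidden pattern contains red and repeats a color. A triangle on a matched pair shows all
    three colors, since the ends of the pair have opposite parities; any other triangle has no red
    edge. *)
Lemma matching_coloring_Forb n :
  matching_coloring n \in Forb n [:: rrb; bbr; yyr].
Proof.
apply/ForbP => x y z xy yz xz; rewrite !matching_coloringE //.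
have [hxy|hxy] := eqVneq x./2 y./2; have [hyz|hyz] := eqVneq y./2 z./2.
- rewrite hxy hyz eqxx; have := matched_odd xz; rewrite hxy hyz => /(_ erefl).
  by rewrite (matched_odd yz hyz) (matched_odd xy hxy) negbK; case: (odd x).
- by rewrite hxy (negPf hyz) (matched_odd xy hxy); case: (odd x); case: (odd z).
- by rewrite -hyz (negPf hxy) (matched_odd yz hyz); case: (odd x); case: (odd y).
have [hxz|hxz] := eqVneq x./2 z./2.
  by rewrite (matched_odd xz hxz); case: (odd x); case: (odd y).
by case: (odd x); case: (odd y); case: (odd z).
Qed.

Lemma h2_matching_coloring n : n <> 2 -> h2 (matching_coloring n) <= uphalf n.
Proof.
move=> hn; apply: h2_leP => S k Sk.
have [/exists_inP[x xS /exists_inP[y yS /andP[xy /eqP hxy]]]|nopair] :=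
  boolP [exists x in S, exists y in S, (x != y) && (x./2 == y./2)].
  (* A third vertex of [S] would form with [x] and [y] a triangle of all three colors, including
     [k]. *)
  have S_sub : S \subset [set x; y].
    apply/subsetP => z zS; rewrite !inE -[_ || _]negbK negb_or.
    apply/negP => /andP[zx zy].
    have := Sk x y xS yS xy; have := Sk z x zS xS zx; have := Sk z y zS yS zy.
    rewrite !matching_coloringE // -hxy eqxx (matched_odd xy hxy).
    have [hzx|_] := eqVneq z./2 x./2.
      have := matched_odd zy; rewrite -hxy hzx => /(_ erefl).
      by rewrite (matched_odd xy hxy) (matched_odd zx hzx) negbK; case: (odd z).
    by case: k {Sk}; case: (odd z); case: (odd x).
  (* The pair has two vertices, and [2 <= uphalf n] means [3 <= n]: this is where [n <> 2]
     enters. *)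
  apply: leq_trans (subset_leq_card S_sub) _; rewrite cards2 xy geq_uphalf_double.
  have : #|[set x; y]| <= n by rewrite -[n in _ <= n]card_ord max_card.
  by rewrite cards2 xy leq_eqVlt => /predU1P[/esym|].
(* Without a matched pair in [S], halving is injective on [S] and takes values below [uphalf n]. *)
have half_lt (x : 'I_n) : x./2 < uphalf n.
  rewrite gtn_uphalf_double; apply: leq_ltn_trans (ltn_ord x).
  by rewrite -[leqRHS]odd_double_half leq_addl.
rewrite -[uphalf n]card_ord; apply: (@leq_card_in _ _ (fun x => Ordinal (half_lt x))).
move=> x y xS yS [/eqP hxy]; apply/eqP; apply: contraNT nopair => xy.
by apply/exists_inP; exists x => //; apply/exists_inP; exists y; rewrite // xy.
Qed.

Theorem lemma3p2 (n : nat) (hn : n <> 2) :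
  h2_min n [:: rrb; bbr; yyr] = uphalf n.
Proof.
rewrite /h2_min -minEnat; apply/eqP; rewrite eqn_leq -!leEnat; apply/andP; split.
  apply: (Order.TotalTheory.bigmin_inf (matching_coloring n)).
    exact: matching_coloring_Forb.
  exact: h2_matching_coloring.
(* The starting value [n] of the minimum must satisfy the bound as well. *)
apply/Order.TotalTheory.bigmin_geP; split=> [|c]; last exact: h2_lower.
by rewrite leEnat leq_uphalf_double -addnn leq_addr.
Qed.
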